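(* Let $G$ be a finite group with normal subgroup $N$. Then $$\Upsilon(G/N)\leq\Upsilon(G)\leq\Upsilon(G/N)\cdot\Upsilon(N).$$ Consequently, if $G$ admits a subnormal series $\{1\}=G_0\lhd G_1\lhd\cdots\lhd G_r=G$, then $$\Upsilon(G)\leq\prod_{i=0}^{r-1}\Upsilon(G_{i+1}/G_i).$$
   Context: For a map $f\colon X\to Y$ of metric spaces, let $\alpha,\beta\in[0,\infty]$ be the largest and smallest constants (respectively) with $\alpha\, d_X(x,x')\le d_Y(f(x),f(x'))\le\beta\, d_X(x,x')$ for all $x,x'\in X$; the distortion of $f$ is $\kappa(f):=\beta/\alpha$, with $\kappa(f)=\infty$ if $\alpha=0$ or $\beta=\infty$. The Euclidean distortion $c_2(X)\in[1,\infty]$ is the infimum of all $c$ for which there exist a Hilbert space $H$ and a map $f\colon X\to H$ with $\kappa(f)=c$ (a one-point space is a degenerate case, for which $c_2$ is taken to be $1$). If a group $G$ acts by isometries on a metric space $X$ with closed orbits, the orbit space $X/G$ carries the quotient metric $d([x],[y])=\inf_{p\in[x],\,q\in[y]}d_X(p,q)$, where $[x]=G\cdot x$. The Euclidean contortion of a finite group $G$ is $\Upsilon(G):=\sup_{V}c_2(V/G)$, where $V$ ranges over all (equivalence classes of) finite-dimensional real orthogonal representations of $G$. *)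

(* Defs.v *)
From HB Require Import structures.
From mathcomp Require Import all_boot all_order all_algebra.
From mathcomp Require Import all_fingroup all_solvable all_character.
From mathcomp Require Import boolp classical_sets reals ereal.
From mathcomp Require Import topology normedtype.
From mathcomp Require Import ring.

Set Implicit Arguments.
Unset Strict Implicit.
Unset Printing Implicit Defensive.

Import Order.TTheory GRing.Theory Num.Theory.
Import numFieldNormedType.Exports.

Local Open Scope classical_set_scope.
Local Open Scope ring_scope.

(* A real Hilbert space.  The [Metric] component adds no data of its own:      *)
(* [ballEmdist] and [pseudo_metric_ball_norm] force mdist x y = `|x - y|.      *)
HB.mixin Record isHilbert (R : realType) H & CompleteNormedModule R H := {
  hinner : {dot H for (@idfun R)} ;
  hinner_norm : forall x : H, `|x| ^+ 2 = hinner x x }.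

#[short(type="hilbertType")]
HB.structure Definition Hilbert (R : realType) :=
  {H of CompleteNormedModule R H & Metric R H & isHilbert R H}.

Section Distortion.
Variable R : realType.
Local Open Scope ereal_scope.

(* As +oo * 0 = 0 in \bar R, +oo is always an upper constant, and it is a      *)
(* lower constant iff X has at most one point.                                 *)
Definition lower_lip (X Y : metricType R) (f : X -> Y) : \bar R :=
  ereal_sup [set a | 0 <= a /\
    forall x x' : X, a * (mdist x x')%:E <= (mdist (f x) (f x'))%:E].

Definition upper_lip (X Y : metricType R) (f : X -> Y) : \bar R :=
  ereal_inf [set b | 0 <= b /\
    forall x x' : X, (mdist (f x) (f x'))%:E <= b * (mdist x x')%:E].

Definition distortion (X Y : metricType R) (f : X -> Y) : \bar R :=
  if (lower_lip f == 0) || (upper_lip f == +oo) then +oo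
  else upper_lip f / lower_lip f.

Definition euclidean_distortion (X : metricType R) : \bar R :=
  if `[< exists x : X, [set: X] = [set x] >] then 1
  else ereal_inf [set c | exists (H : hilbertType R) (f : X -> H),
                            distortion f = c].

End Distortion.

(* 'rV[R]_n carries the sup norm in the library, hence this copy of R^n.       *)
Definition euclidean (R : realType) (n : nat) : Type := 'rV[R]_n.

Section EuclideanSpace.
Variables (R : realType) (n : nat).

HB.instance Definition _ := GRing.Lmodule.copy (euclidean R n) 'rV[R]_n.

Implicit Types x y z : 'rV[R]_n.

Definition eucl_dist (x y : 'rV[R]_n) : R :=
  Num.sqrt (\sum_i (x 0 i - y 0 i) ^+ 2).

Lemma sum_sqr_ge0 (a : 'I_n -> R) : 0 <= \sum_i a i ^+ 2.
Proof. by apply: sumr_ge0 => i _; exact: sqr_ge0. Qed.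

Lemma eucl_dist_ge0 x y : 0 <= eucl_dist x y.
Proof. exact: sqrtr_ge0. Qed.

Lemma eucl_distxx x : eucl_dist x x = 0.
Proof. by rewrite /eucl_dist big1 ?sqrtr0// => i _; rewrite subrr expr0n. Qed.

Lemma eucl_dist_eq0 x y : eucl_dist x y = 0 -> x = y.
Proof.
move=> /eqP; rewrite sqrtr_eq0 => le0.
have /eqP : \sum_i (x 0 i - y 0 i) ^+ 2 = 0.
  by apply/eqP; rewrite eq_le le0 sum_sqr_ge0.
rewrite psumr_eq0; last by move=> i _; exact: sqr_ge0.
move=> /allP h; apply/rowP => i; apply/eqP; rewrite -subr_eq0 -sqrf_eq0.
by have := h i (mem_index_enum _).
Qed.

Lemma eucl_dist_sym x y : eucl_dist x y = eucl_dist y x.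
Proof.
by congr Num.sqrt; apply: eq_bigr => i _; rewrite -sqrrN opprB.
Qed.

Lemma sum_cauchy_schwarz (a b : 'I_n -> R) :
  \sum_i a i * b i <= Num.sqrt (\sum_i a i ^+ 2) * Num.sqrt (\sum_i b i ^+ 2).
Proof.
set A := \sum_i a i ^+ 2; set B := \sum_i b i ^+ 2; set C := \sum_i _.
have [A0 B0] : 0 <= A /\ 0 <= B by split; exact: sum_sqr_ge0.
have key s t : 2 * (s * t) * C <= s ^+ 2 * A + t ^+ 2 * B.
  rewrite -subr_ge0 (_ : _ - _ = \sum_i (s * a i - t * b i) ^+ 2).
    exact: sum_sqr_ge0.
  rewrite !mulr_sumr -big_split -sumrB /=; apply: eq_bigr => i _.
  by ring.
have zero_case (u v : 'I_n -> R) : \sum_i u i ^+ 2 = 0 ->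
    \sum_i u i * v i = 0.
  move=> /eqP; rewrite psumr_eq0 => [/allP h|i _]; last exact: sqr_ge0.
  apply: big1 => i _; have := h i (mem_index_enum _).
  by rewrite sqrf_eq0 => /eqP ->; rewrite mul0r.
have [A00|An0] := eqVneq A 0.
  by rewrite /C zero_case// mulr_ge0 ?sqrtr_ge0.
have [B00|Bn0] := eqVneq B 0.
  have -> : C = \sum_i b i * a i by apply: eq_bigr => i _; rewrite mulrC.
  by rewrite zero_case// mulr_ge0 ?sqrtr_ge0.
have sA : 0 < Num.sqrt A by rewrite sqrtr_gt0 lt_neqAle eq_sym An0.
have sB : 0 < Num.sqrt B by rewrite sqrtr_gt0 lt_neqAle eq_sym Bn0.
have := key (Num.sqrt B) (Num.sqrt A).
rewrite !sqr_sqrtr// (mulrC B) -mulr2n -[A * B *+ 2]mulr_natl -mulrA.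
rewrite ler_pM2l ?ltr0n// -{2}(sqr_sqrtr A0) -{2}(sqr_sqrtr B0) -exprMn expr2.
by rewrite [X in X * C <= _]mulrC ler_pM2l// mulr_gt0.
Qed.

Lemma eucl_dist_triangle y x z :
  eucl_dist x z <= eucl_dist x y + eucl_dist y z.
Proof.
rewrite -(@ler_pXn2r _ 2)// ?nnegrE ?addr_ge0 ?eucl_dist_ge0//.
rewrite sqrrD !sqr_sqrtr ?sum_sqr_ge0//.
have -> : \sum_i (x 0 i - z 0 i) ^+ 2 =
    \sum_i (x 0 i - y 0 i) ^+ 2 +
    (\sum_i (x 0 i - y 0 i) * (y 0 i - z 0 i)) *+ 2 +
    \sum_i (y 0 i - z 0 i) ^+ 2.
  rewrite -sumrMnl -!big_split/=; apply: eq_bigr => i _.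
  by rewrite -sqrrD addrA subrK.
by rewrite lerD2r lerD2l lerMn2r sum_cauchy_schwarz.
Qed.

HB.instance Definition _ := @isMetric.Build R (euclidean R n)
  eucl_dist eucl_distxx eucl_dist_eq0 eucl_dist_sym eucl_dist_triangle.

End EuclideanSpace.

(* Finite-dimensional real orthogonal representations: up to equivalence the   *)
(* underlying Euclidean space is R^n, on which g acts by x |-> x *m V g.       *)
Record orthRep (R : realType) (gT : finGroupType) (G : {group gT}) := OrthRep {
  orth_dim : nat ;
  orth_repr :> mx_representation R G orth_dim ;
  orth_reprP : forall g, g \in G -> orth_repr g *m (orth_repr g)^T = 1%:M }.

Section OrbitSpace.
Variables (R : realType) (gT : finGroupType) (G : {group gT}).
Variable V : orthRep R G.
Let E := euclidean R (orth_dim V).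

Definition orth_act (x : E) (g : gT) : E := x *m V g.

Definition orth_orbit (x : E) : set E := [set orth_act x g | g in [set` G]].

Definition orbit_space : Type := {o : set E | range orth_orbit o}.

HB.instance Definition _ := gen_eqMixin orbit_space.
HB.instance Definition _ := gen_choiceMixin orbit_space.

Definition orbit_dist (o o' : orbit_space) : R :=
  inf [set mdist p q | p in sval o & q in sval o'].

Lemma orth_act1 x : orth_act x 1%g = x.
Proof. by rewrite /orth_act repr_mx1 mulmx1. Qed.

Lemma orth_actM x g h : g \in G -> h \in G ->
  orth_act x (g * h)%g = orth_act (orth_act x g) h.
Proof. by move=> gG hG; rewrite /orth_act repr_mxM// mulmxA. Qed.

Lemma orth_act_isom x y g : g \in G ->
  mdist (orth_act x g) (orth_act y g) = mdist x y.
Proof.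
have eucl_distE (u v : 'rV[R]_(orth_dim V)) :
    eucl_dist u v = Num.sqrt (((u - v) *m (u - v)^T) 0 0).
  by rewrite mxE; congr Num.sqrt; apply: eq_bigr => i _; rewrite !mxE expr2.
move=> gG; rewrite /mdist/= !eucl_distE /orth_act -mulmxBl trmx_mul.
by rewrite mulmxA -[_ *m V g *m _]mulmxA orth_reprP// mulmx1.
Qed.

Lemma orth_orbit_refl x : orth_orbit x x.
Proof. by exists 1%g => /=; [exact: group1|exact: orth_act1]. Qed.

Lemma orth_orbit_act x g : g \in G -> orth_orbit (orth_act x g) = orth_orbit x.
Proof.
move=> gG; apply/seteqP; split => y [h /= hG <-].
  by exists (g * h)%g => /=; rewrite ?groupM// orth_actM.
exists (g^-1 * h)%g => /=; first by rewrite groupM ?groupV.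
by rewrite -orth_actM ?groupM ?groupV// mulKVg.
Qed.

Lemma orbit_spaceE (o : orbit_space) x : sval o x -> sval o = orth_orbit x.
Proof.
by have [y _ <-] := proj2_sig o; move=> [g /= gG <-]; rewrite orth_orbit_act.
Qed.

Lemma orbit_space_rep (o : orbit_space) : exists x, sval o x.
Proof.
by have [x _ <-] := proj2_sig o; exists x; exact: orth_orbit_refl.
Qed.

Lemma orbit_dist_le (o o' : orbit_space) p q :
  sval o p -> sval o' q -> orbit_dist o o' <= mdist p q.
Proof.
move=> op oq; apply: ge_inf; last by exists p => //; exists q.
by exists 0 => _ [u _] [v _ <-]; exact: mdist_ge0.
Qed.

Lemma orbit_dist_attained (o o' : orbit_space) p : sval o p ->
  exists2 q, sval o' q & orbit_dist o o' = mdist p q.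
Proof.
move=> op; have [q oq] := orbit_space_rep o'.
have [g gG gmin] := arg_minP (fun g => mdist p (orth_act q g)) (group1 G).
have ogq : sval o' (orth_act q g).
  by rewrite (orbit_spaceE oq); exists g.
exists (orth_act q g) => //; apply/eqP; rewrite eq_le orbit_dist_le//=.
apply: lb_le_inf; first by exists (mdist p q); exists p => //; exists q.
move=> _ [u ou] [v ov <-].
move: ou ov; rewrite (orbit_spaceE op) (orbit_spaceE oq).
move=> [h /= hG <-] [k /= kG <-].
have hVG : h^-1%g \in G by rewrite groupV.
rewrite -(orth_act_isom (orth_act p h) (orth_act q k) hVG).
rewrite -(orth_actM p hG hVG) -(orth_actM q kG hVG) mulgV orth_act1.
by apply: gmin; exact: groupM.
Qed.

Lemma orbit_distxx o : orbit_dist o o = 0.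
Proof.
have [p op] := orbit_space_rep o; have [q _ oE] := orbit_dist_attained o op.
apply/eqP; rewrite eq_le {2}oE mdist_ge0 andbT.
by rewrite (le_trans (orbit_dist_le op op))// mdistxx.
Qed.

Lemma orbit_dist_eq0 o o' : orbit_dist o o' = 0 -> o = o'.
Proof.
have [p op] := orbit_space_rep o; have [q oq ->] := orbit_dist_attained o' op.
move=> /mdist_positivity pq; rewrite -pq in oq.
have : sval o = sval o' by rewrite (orbit_spaceE op) (orbit_spaceE oq).
by case: o o' {op oq} => [u uP] [v vP] /= uv; exact: eq_exist.
Qed.

Lemma orbit_dist_sym o o' : orbit_dist o o' = orbit_dist o' o.
Proof.
congr inf; apply/seteqP; split => _ [p op] [q oq <-];
  by exists q => //; exists p => //; rewrite metric_sym.
Qed.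

Lemma orbit_dist_triangle o2 o1 o3 :
  orbit_dist o1 o3 <= orbit_dist o1 o2 + orbit_dist o2 o3.
Proof.
have [p op] := orbit_space_rep o1.
have [q oq ->] := orbit_dist_attained o2 op.
have [r or ->] := orbit_dist_attained o3 oq.
exact: le_trans (orbit_dist_le op or) (metric_triangle _ _ _).
Qed.

HB.instance Definition _ := @isMetric.Build R orbit_space
  orbit_dist orbit_distxx orbit_dist_eq0 orbit_dist_sym orbit_dist_triangle.

End OrbitSpace.

Definition contortion (R : realType) (gT : finGroupType) (G : {group gT}) :
    \bar R :=
  ereal_sup [set euclidean_distortion (orbit_space V : metricType R)
            | V in [set: orthRep R G]].

(* Main.v *)
(* If f : V/N -> H is bilipschitz, then x |-> (f(x k)) for k in K = G/N maps    *)
(* V/N equivariantly into H^K with the same distortion, hence embeds V/G in    *)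
(* H^K/K.  As H^K need not be finite-dimensional, its contortion bound is not  *)
(* directly available; but finitely many points of V/G only involve a          *)
(* finite-dimensional subrepresentation (R^m)^K, to which the definition of    *)
(* the contortion of K applies.  So finite subsets of V/G embed in Hilbert     *)
(* spaces with uniform bounds.  Writing these embeddings in triangular         *)
(* (Gram-Schmidt) coordinates along a dense sequence, their coordinatewise     *)
(* limit along an ultrafilter lies in ell2 and loses no distance, and it       *)
(* extends to V/G by completeness.                                             *)

Require Import Defs.
From HB Require Import structures.
From mathcomp Require Import all_boot all_order all_algebra.
From mathcomp Require Import all_fingroup all_solvable mxrepresentation.
From mathcomp Require Import boolp classical_sets functions reals ereal.
From mathcomp Require Import topology normedtype sequences realfun.
From mathcomp Require Import ring lra.

Set Implicit Arguments.
Unset Strict Implicit.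
Unset Printing Implicit Defensive.

Import Order.TTheory GRing.Theory Num.Theory.
Import numFieldNormedType.Exports.

Local Open Scope classical_set_scope.
Local Open Scope ring_scope.

(** * The Hilbert space of square-summable sequences *)

(** The left inequality is inflation: a representation of G/N, read through [coset N], is a
    representation of G with the same orbits, hence the same orbit space ([contortion_quotient_le]).

    For the right one, put K = G/N and take reals c, d strictly above the contortions of K and N.
    Given a representation V of G, there is f : V/N -> H with constants a and d a. Since N is
    normal, K acts on V/N by isometries, and dist(xG, yG) is the minimum over h in K of dist(xN,
    yhN). The distance between (f(xk))_k and the h-translate of (f(yk))_k then lies between b
    dist(xN, yhN) and d b dist(xN, yhN), where b = sqrt |K| a. For finitely many points the values
    of f can be replaced by coordinates in some R^m, which gives points of an orthogonal
    representation of K ([induced_quotient_rep]). Minimising over h and applying the contortion of K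
    embeds these orbits with constants b and c d b after rescaling. The constants do not depend on
    the finite set, so [separable_bilipschitz_limit] embeds all of V/G in [ell2]. Letting c and d
    decrease to the contortions gives the product ([le_of_real_ubounds_mul]).

    The bound for a subnormal series follows by induction from the trivial group, whose orbit spaces
    are Euclidean ([contortion1]). *)

Section SquareSummable.
Variable R : realType.
Implicit Types (a b : nat -> R) (c : R).

Definition square_summable : {pred (nat -> R)} :=
  [pred a : nat -> R | `[< exists M, forall n, \sum_(k < n) a k ^+ 2 <= M >]].

Lemma square_summableP a :
  reflect (exists M, forall n, \sum_(k < n) a k ^+ 2 <= M)
          (a \in square_summable).
Proof. exact: asboolP. Qed.

Lemma square_summable_submod : submod_closed square_summable.
Proof.
split=> [|c a b /square_summableP[M aM] /square_summableP[N bN]].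
  apply/square_summableP; exists 0 => n; rewrite big1// => k _.
  by rewrite expr0n.
(* The bound comes from (s + t)^2 <= 2 s^2 + 2 t^2, applied termwise. *)
apply/square_summableP; exists (2 * c ^+ 2 * M + 2 * N) => n.
apply: (@le_trans _ _ (\sum_(k < n) (2 * c ^+ 2 * a k ^+ 2 + 2 * b k ^+ 2))).
  apply: ler_sum => k _; rewrite [X in X ^+ 2](_ : _ = c * a k + b k)//.
  by rewrite -subr_ge0 [leRHS](_ : _ = (c * a k - b k) ^+ 2) ?sqr_ge0//; ring.
by rewrite big_split /= -!mulr_sumr; apply: lerD; apply: ler_wpM2l;
  rewrite ?aM ?bN// mulr_ge0 ?sqr_ge0.
Qed.

HB.instance Definition _ := GRing.isSubmodClosed.Build R (nat -> R)
  square_summable square_summable_submod.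

Record ell2 := Ell2 {
  ell2_fun :> nat -> R;
  ell2P : ell2_fun \in square_summable }.

HB.instance Definition _ := [isSub for ell2_fun].
HB.instance Definition _ := [Choice of ell2 by <:].
HB.instance Definition _ := [SubChoice_isSubLmodule of ell2 by <:].

Implicit Types x y z : ell2.

Lemma ell2D x y k : ell2_fun (x + y) k = x k + y k. Proof. by []. Qed.

Definition ell2_dot x y : R := limn (fun n => \sum_(k < n) x k * y k).

(** By polarization the terms are ((x + y)^2 - x^2 - y^2) / 2, and series of squares have monotone
    bounded partial sums. *)
Lemma ell2_dot_cvg x y :
  (fun n => \sum_(k < n) x k * y k) @ \oo --> ell2_dot x y.
Proof.
have sq z : cvgn (fun n => \sum_(k < n) z k ^+ 2).
  have /square_summableP[M zM] := ell2P z.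
  apply: nondecreasing_is_cvgn; last by exists M => _ [n _ <-].
  by apply/nondecreasing_seqP => n; rewrite big_ord_recr/= lerDl sqr_ge0.
suff : cvgn (fun n => \sum_(k < n) x k * y k) by [].
rewrite (_ : (fun n => _) = fun n => 2^-1 *
  (\sum_(k < n) (x + y) k ^+ 2 -
   \sum_(k < n) x k ^+ 2 - \sum_(k < n) y k ^+ 2)).
  by apply: is_cvgM; [exact: is_cvg_cst|apply: is_cvgB; first apply: is_cvgB].
apply/funext => n; rewrite -!sumrB mulr_sumr; apply: eq_bigr => k _.
by rewrite ell2D; field.
Qed.

Lemma ell2_dotC x y : ell2_dot x y = ell2_dot y x.
Proof.
by congr (limn _); apply/funext => n; apply: eq_bigr => k _; rewrite mulrC.
Qed.

Lemma ell2_dotP c x y z :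
  ell2_dot (c *: x + y) z = c * ell2_dot x z + ell2_dot y z.
Proof.
rewrite {1}/ell2_dot; apply: cvg_lim => //.
rewrite (_ : (fun n => _) = fun n => c * (\sum_(k < n) x k * z k) +
   \sum_(k < n) y k * z k).
  by apply: cvgD; [apply: cvgM; first exact: cvg_cst|]; exact: ell2_dot_cvg.
apply/funext => n; rewrite mulr_sumr -big_split; apply: eq_bigr => k _ /=.
by rewrite [X in X * z k](_ : _ = c * x k + y k)//; ring.
Qed.

Lemma ell2_dotDl x y z : ell2_dot (x + y) z = ell2_dot x z + ell2_dot y z.
Proof. by rewrite -[x in LHS]scale1r ell2_dotP mul1r. Qed.

Lemma ell2_dotZl z : scalable_for *%R (ell2_dot^~ z).
Proof.
move=> c x; have := ell2_dotP c x (- 0) z; rewrite oppr0 addr0 => ->.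
have := ell2_dotP 1 0 0 z; rewrite scaler0 addr0 mul1r; lra.
Qed.

Lemma ell2_psum_le x n : \sum_(k < n) x k ^+ 2 <= ell2_dot x x.
Proof.
apply: (@nondecreasing_cvgn_le _ (fun n => \sum_(k < n) x k ^+ 2)).
  by apply/nondecreasing_seqP => m; rewrite big_ord_recr/= lerDl sqr_ge0.
exact: ell2_dot_cvg.
Qed.

Lemma ell2_dot_ge0 x : 0 <= ell2_dot x x.
Proof. by apply: le_trans (ell2_psum_le x 0); rewrite big_ord0. Qed.

Lemma ell2_dot_eq0 x : ell2_dot x x = 0 -> x = 0.
Proof.
move=> x0; apply/val_inj/funext => k; apply/eqP.
rewrite -sqrf_eq0 eq_le sqr_ge0 andbT -x0.
rewrite (le_trans _ (ell2_psum_le x k.+1))// big_ord_recr/= lerDr.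
by rewrite sumr_ge0// => i _; rewrite sqr_ge0.
Qed.

Definition ell2_norm x : R := Num.sqrt (ell2_dot x x).

Lemma ell2_CauchySchwarz x y : ell2_dot x y <= ell2_norm x * ell2_norm y.
Proof.
apply: (cvgr_to_le (@ell2_dot_cvg x y)); apply: nearW => n.
apply: le_trans (sum_cauchy_schwarz _ _) _.
by rewrite ler_pM ?sqrtr_ge0// ler_wsqrtr// ell2_psum_le.
Qed.

Lemma ell2_norm_triangle x y : ell2_norm (x + y) <= ell2_norm x + ell2_norm y.
Proof.
rewrite -(@ler_pXn2r _ 2)// ?nnegrE ?addr_ge0 ?sqrtr_ge0//.
rewrite sqrrD !sqr_sqrtr ?ell2_dot_ge0//.
have -> : ell2_dot (x + y) (x + y) =
    ell2_dot x x + ell2_dot x y *+ 2 + ell2_dot y y.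
  rewrite ell2_dotDl ![ell2_dot _ (_ + _)]ell2_dotC !ell2_dotDl.
  by rewrite (ell2_dotC y x); ring.
by rewrite lerD2r lerD2l lerMn2r ell2_CauchySchwarz.
Qed.

Lemma ell2_normZ c x : ell2_norm (c *: x) = `|c| * ell2_norm x.
Proof.
rewrite /ell2_norm ell2_dotZl ell2_dotC ell2_dotZl mulrA -expr2.
by rewrite sqrtrM ?sqr_ge0// sqrtr_sqr.
Qed.

Lemma ell2_norm_eq0 x : ell2_norm x = 0 -> x = 0.
Proof.
move=> /eqP; rewrite sqrtr_eq0 => x0; apply: ell2_dot_eq0; apply/eqP.
by rewrite eq_le x0 ell2_dot_ge0.
Qed.

HB.instance Definition _ := @Lmodule_isNormed.Build R ell2 ell2_norm
  ell2_norm_triangle ell2_normZ ell2_norm_eq0.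


Lemma ell2_sqr_norm x : `|x| ^+ 2 = ell2_dot x x.
Proof. by rewrite sqr_sqrtr// ell2_dot_ge0. Qed.

Lemma ell2_norm_ge_coord x k : `|x k| <= `|x|.
Proof.
rewrite -(@ler_pXn2r _ 2)// ?nnegrE// ell2_sqr_norm real_normK ?num_real//.
rewrite (le_trans _ (ell2_psum_le x k.+1))// big_ord_recr/= lerDr.
by rewrite sumr_ge0// => i _; rewrite sqr_ge0.
Qed.

Lemma ell2_norm_le (f : nat -> R) (e : R) : 0 <= e ->
  (forall n, \sum_(k < n) f k ^+ 2 <= e ^+ 2) ->
  exists2 x : ell2, ell2_fun x = f & `|x| <= e.
Proof.
move=> e0 fe.
have fP : f \in square_summable by apply/square_summableP; exists (e ^+ 2).
exists (Ell2 fP) => //; rewrite -(@ler_pXn2r _ 2)// ?nnegrE// ell2_sqr_norm.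
by apply: (cvgr_to_le (@ell2_dot_cvg _ _)); exact: nearW.
Qed.

(** Coordinates converge along F, to [f] say. Letting y run along F in the partial sums of (x - y)^2
    bounds those of (x - f)^2, so x - f lies in [ell2] and is small; the limit is x - (x - f). *)
Lemma ell2_complete (F : set_system ell2) : ProperFilter F -> cauchy F -> cvg F.
Proof.
move=> FF /cauchyP Fc.
have coord k : cvg ((fun x : ell2 => x k) @ F).
  apply: cauchy_cvg; apply/cauchyP => e e0; have [c Fce] := Fc _ e0.
  exists (c k); suff : F [set x : ell2 | ball (c k) e (x k)] by [].
  apply: filterS Fce => x; rewrite -!ball_normE/=.
  by apply: le_lt_trans; exact: (ell2_norm_ge_coord (c - x) k).
pose f k := lim ((fun x : ell2 => x k) @ F).
have close e : 0 < e -> \forall x \near F,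
    exists2 z : ell2, ell2_fun z = ell2_fun x \- f & `|z| <= e.
  move=> e0; have e20 : 0 < e / 2 by rewrite divr_gt0.
  have [c Fce] := Fc _ e20; apply: filterS (Fce) => x cx.
  apply: ell2_norm_le => [|n]; first exact: ltW.
  have : (fun y : ell2 => \sum_(k < n) (x k - y k) ^+ 2) @ F -->
      \sum_(k < n) (x k - f k) ^+ 2.
    apply: cvg_big => [|k _]; first exact: add_continuous.
    apply: cvgM; (apply: cvgB; first exact: cvg_cst); exact: coord.
  move=> /cvgr_to_le; apply; apply: filterS Fce => y cy.
  apply: le_trans (ell2_psum_le (x - y) n) _; rewrite -ell2_sqr_norm.
  rewrite ler_pXn2r ?nnegrE// ?(ltW e0)//.
  move: cx cy; rewrite -!ball_normE/= => cx cy.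
  rewrite -(subrKA c) (le_trans (ler_normD _ _))// [e]splitr lerD// ltW//.
  by rewrite distrC.
have [x [y yE _]] := filter_ex (close 1 ltr01).
apply/cvg_ex; exists (x - y); apply/cvgrPdist_le => e e0.
apply: filterS (close e e0) => x' [z zE ze].
rewrite distrC (_ : x' - _ = z)//; apply/val_inj/funext => k.
rewrite [RHS](_ : _ = ell2_fun z k)// zE.
by rewrite [LHS](_ : _ = x' k - (x k - y k))// yE /=; ring.
Qed.

HB.instance Definition _ := Uniform_isComplete.Build ell2 ell2_complete.

Let ell2_mdist x y := `|x - y|.
Let ell2_mdist_ge0 x y : 0 <= ell2_mdist x y. Proof. exact: normr_ge0. Qed.
Let ell2_mdist_eq0 x y : ell2_mdist x y = 0 -> x = y.
Proof. by move=> /eqP; rewrite normr_eq0 subr_eq0 => /eqP. Qed.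
Let ell2_ballE x d : ball x d = [set y | ell2_mdist x y < d].
Proof. by rewrite -ball_normE. Qed.

HB.instance Definition _ := PseudoMetric_isMetric.Build R ell2
  ell2_mdist_ge0 ell2_mdist_eq0 ell2_ballE.

Let ell2_dotBl z : zmod_morphism (ell2_dot^~ z).
Proof. by move=> x y; rewrite addrC -scaleN1r ell2_dotP mulN1r addrC. Qed.
Let ell2_dotBr z : zmod_morphism (ell2_dot z).
Proof. by move=> x y; rewrite !(ell2_dotC z); exact: ell2_dotBl. Qed.
Let ell2_dotZr z : scalable_for (idfun \; *%R) (ell2_dot z).
Proof. by move=> c x; rewrite !(ell2_dotC z); exact: ell2_dotZl. Qed.
HB.instance Definition _ := isBilinear.Build R ell2 ell2 R *%R (idfun \; *%R)
  ell2_dot ell2_dotBl ell2_dotBr ell2_dotZl ell2_dotZr.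
Let ell2_dot_hermitian x y :
  ell2_dot x y = (-1) ^+ false * idfun (ell2_dot y x).
Proof. by rewrite mul1r ell2_dotC. Qed.
HB.instance Definition _ := isHermitianSesquilinear.Build R ell2
  false idfun ell2_dot ell2_dot_hermitian.
Let ell2_dot_gt0 x : x != 0 -> 0 < ell2_dot x x.
Proof.
move=> x0; rewrite lt_neqAle ell2_dot_ge0 andbT eq_sym.
by apply: contra_neq x0; exact: ell2_dot_eq0.
Qed.
HB.instance Definition _ := isDotProduct.Build R ell2 ell2_dot ell2_dot_gt0.
HB.instance Definition _ := isHilbert.Build R ell2 ell2_sqr_norm.

End SquareSummable.

(** * Embeddings of finite subsets have a limit *)

Section UltrafilterLimit.
Variable R : realType.

(** The image of U is an ultrafilter containing the compact segment [-M, M]. *)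
Lemma ultra_bounded_cvg (U : set_system nat) (u : nat -> R) M : UltraFilter U ->
  (\forall n \near U, `|u n| <= M) -> cvg (u @ U).
Proof.
move=> UU uM.
have Uu : UltraFilter (u @ U).
  split; first exact: fmap_proper_filter.
  move=> G GG uUG; apply/seteqP; split=> A; last exact: uUG.
  move=> GA; have [//|nA] := in_ultra_setVsetC (u @^-1` A) UU.
  have /filter_ex[x []//] : G (A `&` ~` A) by apply: filterI => //; apply: uUG.
have := @segment_compact R (- M) M; rewrite compact_ultra => /(_ _ Uu)[].
  by apply: filterS uM => n; rewrite /= in_itv/= ler_norml.
by move=> x [_ ux]; apply/cvg_ex; exists x.
Qed.
End UltrafilterLimit.


(** * Triangular coordinates of finitely many vectors *)

Section Coordinates.
Variables (R : realType) (H : hilbertType R).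
Local Notation "''[' u , v ]" := (hinner u v).

Lemma hinnerC (u v : H) : '[u, v] = '[v, u].
Proof. by rewrite (hermC (hinner : {dot H for idfun})) mul1r. Qed.

Lemma hinner_suml I r (P : pred I) (F : I -> H) v :
  '[\sum_(i <- r | P i) F i, v] = \sum_(i <- r | P i) '[F i, v].
Proof. exact: (linear_sumlz (hinner : {dot H for idfun})). Qed.

Lemma hinnerZl c (u v : H) : '[c *: u, v] = c * '[u, v].
Proof. exact: (linearZl_LR hinner). Qed.

Lemma hinnerBl (u v w : H) : '[u - v, w] = '[u, w] - '[v, w].
Proof. exact: (linearBl hinner). Qed.

Lemma hinner_dist (u v : H) : `|u - v| ^+ 2 = '[u, u] - '[u, v] *+ 2 + '[v, v].
Proof.
rewrite hinner_norm hinnerBl hinnerC (hinnerC v) !hinnerBl (hinnerC u v) mulr2n.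
by ring.
Qed.

Definition orthonormal_or_zero n (e : nat -> H) :=
  forall i j, (i < n)%N -> (j < n)%N ->
    '[e i, e j] = if i == j then (e i != 0)%:R else 0.

Lemma gram_schmidt (v : nat -> H) n : exists2 e : nat -> H,
  orthonormal_or_zero n e &
  forall i, (i < n)%N -> v i = \sum_(k < i.+1) '[v i, e k] *: e k.
Proof.
elim: n => [|n [e eO ev]]; first by exists (fun=> 0).
pose r := v n - \sum_(k < n) '[v n, e k] *: e k.
have rO j : (j < n)%N -> '[r, e j] = 0.
  move=> jn; rewrite hinnerBl hinner_suml (bigD1 (Ordinal jn))//= hinnerZl eO//.
  rewrite eqxx big1 ?addr0 => [|k kj].
    case: eqVneq => [->|_]; rewrite ?mulr1 ?subrr//.
    by rewrite hinnerC linear0l mul0r subr0.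
  by rewrite hinnerZl eO ?ltn_ord// ifN ?mulr0.
(* As 0^-1 = 0, en = 0 when v n depends on the previous vectors. *)
pose en := `|r|^-1 *: r.
have enO j : (j < n)%N -> '[en, e j] = 0.
  by move=> jn; rewrite hinnerZl rO ?mulr0.
have r_en : '[r, en] *: en = r.
  have [r0|r0] := eqVneq r 0; first by rewrite /en r0 !scaler0.
  rewrite hinnerC hinnerZl -hinner_norm /en scalerA mulrAC -expr2 -exprMn.
  by rewrite mulVf ?normr_eq0// expr1n scale1r.
have en1 : '[en, en] = (en != 0)%:R.
  have [->|en0] := eqVneq en 0; first by rewrite linear0l.
  have r0 : r != 0 by apply: contra_neq en0; rewrite /en => ->; rewrite scaler0.
  rewrite -hinner_norm normrZ normfV normr_id mulVf ?expr1n ?normr_eq0//.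
exists (fun k => if k == n then en else e k) => [i j|i]; rewrite !ltnS.
  case: (ltngtP i n) => [ilt|//|->] _.
    case: (ltngtP j n) => [jlt|//|->] _; first exact: eO.
    by rewrite hinnerC enO// ltn_eqF.
  by case: (ltngtP j n) => [jlt|//|_] _; first exact: enO.
rewrite leq_eqVlt => /predU1P[->|ilt].
  rewrite big_ord_recr/= eqxx; under eq_bigr => k _ do rewrite ltn_eqF//.
  have -> : '[v n, en] = '[r, en].
    rewrite hinnerBl hinner_suml big1 ?subr0// => k _.
    by rewrite hinnerZl [X in _ * X]hinnerC enO ?mulr0.
  by rewrite r_en /r addrC subrK.
rewrite [LHS]ev//; apply: eq_bigr => k _; rewrite ltn_eqF//.
exact: leq_trans (ltn_ord k) ilt.
Qed.

(* Triangularity gives v i finitely many coordinates, independently of n, so   *)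
(* that distances pass to coordinatewise limits as n grows.                    *)
Lemma triangular_coordinates (v : nat -> H) n : exists2 w : nat -> nat -> R,
  forall i k, (i < k)%N -> w i k = 0 &
  forall i j m, (i < m)%N -> (j < m)%N -> (m <= n)%N ->
    '[v i, v j] = \sum_(k < m) w i k * w j k.
Proof.
have [e eO ev] := gram_schmidt v n.
(* The cutoff makes [w i k] vanish for all k > i, also at k >= n, where [e k] is unconstrained. *)
pose w i k := if (k <= i)%N then '[v i, e k] else 0.
have vE i m : (i < m)%N -> (m <= n)%N -> v i = \sum_(k < m) w i k *: e k.
  move=> im mn; rewrite [LHS]ev ?(leq_trans im)//.
  rewrite (big_ord_widen _ (fun k => '[v i, e k] *: e k) im) big_mkcond/=.
  by apply: eq_bigr => k _; rewrite /w ltnS; case: ifP; rewrite ?scale0r.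
exists w => [i k|i j m im jm mn]; first by rewrite /w ltnNge => /negbTE ->.
rewrite (vE i m im mn) hinner_suml; apply: eq_bigr => k _.
have kn : (k < n)%N := leq_trans (ltn_ord k) mn.
rewrite hinnerZl (vE j m jm mn) hinnerC hinner_suml (bigD1 k)//= hinnerZl eO//.
rewrite eqxx big1 ?addr0 => [|l lk]; last first.
  by rewrite hinnerZl eO ?(leq_trans _ mn)// ifN ?mulr0.
(* A zero [e k] has squared norm 0 instead of 1, but then [w i k] vanishes too. *)
have [ek0|_] := eqVneq (e k) 0; last by rewrite mulr1.
by rewrite /w ek0; case: ifP; rewrite ?mul0r// hinnerC linear0l !mul0r.
Qed.

End Coordinates.

(** * Limits of embeddings of finite subsets *)

Section HilbertLimit.
Variable R : realType.

(** Both distances define the same open balls, so neither can be the larger one. *)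
Lemma hilbert_mdist (H : hilbertType R) (x y : H) : mdist x y = `|x - y|.
Proof.
apply/eqP; rewrite eq_le; apply/andP; split; rewrite leNgt; apply/negP => xy.
  have : ball x (mdist x y) y by rewrite -ball_normE.
  by rewrite ballEmdist/= ltxx.
have : ball x `|x - y| y by rewrite ballEmdist.
by rewrite -ball_normE/= ltxx.
Qed.

Lemma ell2_of_finite (f : nat -> R) m : (forall k, (m <= k)%N -> f k = 0) ->
  f \in @square_summable R.
Proof.
move=> f0; apply/square_summableP; exists (\sum_(k < m) f k ^+ 2) => n.
have [nm|mn] := leqP n m.
  rewrite (big_ord_widen _ (fun k => f k ^+ 2) nm) big_mkcond/=.
  by apply: ler_sum => k _; case: ifP => // _; rewrite sqr_ge0.
rewrite (big_ord_widen _ (fun k => f k ^+ 2) (ltnW mn)) [leRHS]big_mkcond/=.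
by apply: ler_sum => k _; case: ltnP => // mk; rewrite f0// expr0n.
Qed.

Lemma ell2_finite_norm (x : ell2 R) m :
  (forall k, (m <= k)%N -> ell2_fun x k = 0) ->
  `|x| ^+ 2 = \sum_(k < m) ell2_fun x k ^+ 2.
Proof.
move=> x0; rewrite ell2_sqr_norm; apply/eqP; rewrite eq_le ell2_psum_le andbT.
apply: (cvgr_to_le (@ell2_dot_cvg _ x x)); exists m => // n /= mn.
rewrite -!(big_mkord xpredT (fun k => ell2_fun x k ^+ 2)) (big_cat_nat _ mn)//=.
rewrite [X in _ + X]big1_seq ?addr0// => k /andP[_].
by rewrite mem_index_iota => /andP[/x0-> _]; rewrite expr0n.
Qed.

(** With [g 0] moved to the origin, the triangular coordinates of [g i] are bounded by B s(i, 0),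
    uniformly in n, so they converge along an ultrafilter. A pair i, j involves only the first
    max(i, j) + 1 coordinates: its distance is a finite sum and keeps its bounds in the limit. *)
Lemma gram_matrix_limit (s : nat -> nat -> R) (A B : R) : 0 <= A -> 0 <= B ->
  (forall n, exists (H : hilbertType R) (g : nat -> H), forall i j, (i < n)%N ->
    (j < n)%N -> A * s i j <= `|g i - g j| <= B * s i j) ->
  exists p : nat -> ell2 R, forall i j, A * s i j <= `|p i - p j| <= B * s i j.
Proof.
move=> A0 B0 hyp.
have {hyp} /choice[w wP] : forall n, exists w : nat -> nat -> R,
    (forall i k, (i < k)%N -> w i k = 0) /\
    forall i j m, (i < m)%N -> (j < m)%N -> (m <= n)%N ->
      A * s i j <= Num.sqrt (\sum_(k < m) (w i k - w j k) ^+ 2) <= B * s i j /\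
      Num.sqrt (\sum_(k < m) w i k ^+ 2) <= B * s i 0%N.
  move=> n; have [H [g gP]] := hyp n.
  have [w w0 wE] := triangular_coordinates (fun i => g i - g 0%N) n.
  exists w; split=> // i j m im jm mn.
  have dE l : (l < m)%N ->
      Num.sqrt (\sum_(k < m) (w i k - w l k) ^+ 2) = `|g i - g l|.
    move=> lm; rewrite -[RHS]ger0_norm// -sqrtr_sqr; congr Num.sqrt.
    rewrite (_ : g i - g l = (g i - g 0%N) - (g l - g 0%N));
      last by rewrite opprB addrA subrK.
    rewrite hinner_dist !(wE _ _ m)//.
    rewrite -sumrMnl -sumrB -big_split; apply: eq_bigr => k _ /=.
    by rewrite sqrrB !expr2.
  have m0 : (0 < m)%N by exact: leq_ltn_trans im.
  rewrite dE// gP ?(leq_trans _ mn)//; split=> //.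
  (* As [g 0 - g 0] is zero, the norm of [w i] is its distance from [w 0], which the upper bound
     controls. *)
  have w00 k : w 0%N k = 0.
    case: k => [|k]; last exact: w0.
    apply/eqP; rewrite -sqrf_eq0 expr2; apply/eqP.
    have := wE 0%N 0%N 1%N isT isT (leq_trans m0 mn).
    by rewrite big_ord1 => <-; rewrite subrr linear0l.
  under eq_bigr => k _ do rewrite -[w i k]subr0 -(w00 k).
  by rewrite dE//; have /andP[] := gP i 0%N (leq_trans im mn) (leq_trans m0 mn).
(* U contains all tails, so bounds valid for m <= n hold eventually along U. *)
have [U [UU ooU]] := ultraFilterLemma eventually_filter.
have Uge m : \forall n \near U, (m <= n)%N by apply: ooU; exists m.
have wcvg i k : cvg ((fun n => w n i k) @ U).
  apply: (@ultra_bounded_cvg _ _ _ (B * s i 0%N)) => //.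
  pose m := (maxn i k).+1.
  apply: filterS (Uge m) => n mn; have [_ /(_ i i m)] := wP n.
  rewrite ltnS leq_maxl => /(_ isT isT mn)[_]; apply: le_trans.
  have km : (k < m)%N by rewrite ltnS leq_maxr.
  rewrite -sqrtr_sqr ler_wsqrtr// (bigD1 (Ordinal km))//= lerDl.
  by rewrite sumr_ge0// => l _; rewrite sqr_ge0.
pose f i k := lim ((fun n => w n i k) @ U).
have f0 i k : (i < k)%N -> f i k = 0.
  move=> ik; rewrite /f (_ : (fun n => _) = cst 0) ?lim_cst//.
  by apply/funext => n; have [->] := wP n.
pose p i := Ell2 (@ell2_of_finite (f i) i.+1 (f0 i)).
exists p => i j; pose m := (maxn i j).+1.
have im : (i < m)%N by rewrite ltnS leq_maxl.
have jm : (j < m)%N by rewrite ltnS leq_maxr.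
have pE : `|p i - p j| = Num.sqrt (\sum_(k < m) (f i k - f j k) ^+ 2).
  rewrite -[LHS]ger0_norm// -sqrtr_sqr (@ell2_finite_norm _ m)// => k mk.
  rewrite [LHS](_ : _ = f i k - f j k)// !f0 ?subrr//.
    exact: leq_trans jm mk.
  exact: leq_trans im mk.
have cvgd : (fun n => Num.sqrt (\sum_(k < m) (w n i k - w n j k) ^+ 2)) @ U -->
    `|p i - p j|.
  rewrite pE; apply: continuous_cvg; first exact: sqrt_continuous.
  apply: cvg_big => [|k _]; first exact: add_continuous.
  by apply: cvgM; apply: cvgB; exact: wcvg.
apply/andP; split.
  apply: (cvgr_to_ge cvgd); apply: filterS (Uge m) => n mn.
  by have [_ /(_ i j m im jm mn)[/andP[]]] := wP n.
apply: (cvgr_to_le cvgd); apply: filterS (Uge m) => n mn.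
by have [_ /(_ i j m im jm mn)[/andP[]]] := wP n.
Qed.

(** Each x is approximated by points [s (t x n)] within 1/(n+1). The upper bound makes their images
    Cauchy, and both bounds survive the limit. *)
Lemma dense_bilipschitz_extension (X : metricType R) (s : nat -> X)
    (H : hilbertType R) (p : nat -> H) (A B : R) : 0 <= A -> 0 <= B ->
  (forall x e, 0 < e -> exists i, mdist x (s i) < e) ->
  (forall i j,
    A * mdist (s i) (s j) <= `|p i - p j| <= B * mdist (s i) (s j)) ->
  exists f : X -> H,
    forall x y, A * mdist x y <= mdist (f x) (f y) <= B * mdist x y.
Proof.
move=> A0 B0 s_dense pP.
have /choice[t' t'P] (xn : X * nat) :
    exists i, mdist xn.1 (s i) < xn.2.+1%:R^-1.
  by apply: s_dense; rewrite invr_gt0.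
pose t x n := t' (x, n); have tP x n : mdist x (s (t x n)) < n.+1%:R^-1.
  exact: (t'P (x, n)).
have tri (x y x' y' : X) : mdist x y <= mdist x x' + mdist y y' + mdist x' y'.
  rewrite (le_trans (metric_triangle _ x' _))// -addrA lerD2l addrC.
  by rewrite (metric_sym y) metric_triangle.
have pc x : cvgn (p \o t x).
  apply: cauchy_cvg; apply/cauchyP => e e0.
  (* B + 1 replaces B, which may be 0; the images will differ by at most B e / (B + 1) < e. *)
  have Be : 0 < e / (2 * (B + 1)) by rewrite divr_gt0// mulr_gt0// ltr_wpDl.
  have [N _ NP] := near_infty_natSinv_lt (PosNum Be).
  exists (p (t x N)); exists N => // n /= Nn; rewrite -ball_normE/=.
  have /andP[_ /le_lt_trans] := pP (t x N) (t x n); apply.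
  have : mdist (s (t x N)) (s (t x n)) <= e / (B + 1).
    apply: le_trans (metric_triangle _ x _) _; rewrite metric_sym.
    have -> : e / (B + 1) = e / (2 * (B + 1)) + e / (2 * (B + 1)).
      by field; rewrite gt_eqF// ltr_wpDl.
    by apply: lerD; apply: ltW; apply: lt_trans (tP _ _) _;
      [exact: (NP _ (leqnn N))|exact: (NP _ Nn)].
  move=> dle; rewrite (@le_lt_trans _ _ (B * (e / (B + 1))))// ?ler_wpM2l//.
  by rewrite mulrCA gtr_pMr// ltr_pdivrMr ?ltr_wpDl// mul1r ltrDl.
exists (fun x => limn (p \o t x)) => x y; rewrite hilbert_mdist.
have cd : (fun n => `|p (t x n) - p (t y n)|) @ \oo -->
    `|limn (p \o t x) - limn (p \o t y)|.
  by apply: cvg_norm; apply: cvgB; exact: pc.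
have cs : (fun n => mdist (s (t x n)) (s (t y n))) @ \oo --> mdist x y.
  apply/cvgrPdist_le => e e0.
  have e20 : 0 < e / 2 by rewrite divr_gt0.
  have [N _ NP] := near_infty_natSinv_lt (PosNum e20).
  exists N => // n /= Nn; have /= en := NP n Nn.
  have := tri x y (s (t x n)) (s (t y n)).
  have := tri (s (t x n)) (s (t y n)) x y.
  rewrite (metric_sym (s (t x n)) x) (metric_sym (s (t y n)) y).
  have := tP x n; have := tP y n; rewrite ler_norml.
  move: en; set d := mdist x y; set d' := mdist (s (t x n)) _.
  set a := mdist x _; set b := mdist y _; set c := n.+1%:R^-1.
  by move=> *; apply/andP; split; lra.
apply/andP; split.
  apply: (ler_cvg_to (cvgM (cvg_cst A) cs) cd); apply: nearW => n.
  by have /andP[] := pP (t x n) (t y n).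
apply: (ler_cvg_to cd (cvgM (cvg_cst B) cs)); apply: nearW => n.
by have /andP[] := pP (t x n) (t y n).
Qed.

Lemma separable_bilipschitz_limit (X : metricType R) (s : nat -> X) (A B : R) :
  0 <= A -> 0 <= B ->
  (forall x e, 0 < e -> exists i, mdist x (s i) < e) ->
  (forall n, exists (H : hilbertType R) (g : nat -> H), forall i j, (i < n)%N ->
    (j < n)%N ->
    A * mdist (s i) (s j) <= mdist (g i) (g j) <= B * mdist (s i) (s j)) ->
  exists f : X -> ell2 R,
    forall x y, A * mdist x y <= mdist (f x) (f y) <= B * mdist x y.
Proof.
move=> A0 B0 s_dense hyp.
have [|p pP] := @gram_matrix_limit (fun i j => mdist (s i) (s j)) A B A0 B0.
  move=> n; have [H [g gP]] := hyp n; exists H, g => i j im jm.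
  by rewrite -hilbert_mdist gP.
exact: dense_bilipschitz_extension pP.
Qed.

End HilbertLimit.

(** * Distortion and contortion through bilipschitz maps *)

Section EuclideanDistortion.
Variable R : realType.
Implicit Types (X : metricType R) (c a : R).

Definition bilipschitz X (Y : metricType R) (f : X -> Y) (a b : R) :=
  forall x y, a * mdist x y <= mdist (f x) (f y) <= b * mdist x y.

Lemma bilipschitz_euclidean_distortion X (H : hilbertType R) (f : X -> H) a c :
  0 < a -> 1 <= c -> bilipschitz f a (c * a) ->
  (euclidean_distortion X <= c%:E)%E.
Proof.
move=> a0 c1 fP; rewrite /euclidean_distortion; case: asboolP => [_|X1].
  by rewrite lee_fin.
apply: ge_ereal_inf; exists (distortion f); first by exists H, f.
have c0 : 0 < c by exact: lt_le_trans c1.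
have lo : (a%:E <= lower_lip f)%E.
  apply: ereal_sup_ubound; split=> [|x y]; first by rewrite lee_fin ltW.
  by rewrite -EFinM lee_fin; have /andP[] := fP x y.
have up : (upper_lip f <= (c * a)%:E)%E.
  apply: ereal_inf_lbound; split=> [|x y].
    by rewrite lee_fin ltW// mulr_gt0.
  by rewrite -EFinM lee_fin; have /andP[] := fP x y.
have up0 : (0 <= upper_lip f)%E by apply: le_ereal_inf_tmp => b [].
rewrite /distortion gt_eqF ?(lt_le_trans _ lo) ?lte_fin//=.
rewrite lt_eqF ?(le_lt_trans up) ?ltry//.
case: (lower_lip f) lo => [l| |]//; rewrite ?lee_fin => al.
  have l0 : 0 < l by exact: lt_le_trans al.
  rewrite inver gt_eqF//.
  apply: le_trans (lee_wpmul2r _ up) _; rewrite ?lee_fin ?invr_ge0 ?(ltW l0)//.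
  by rewrite ler_pdivrMr// ler_pM2l.
(* Here [lower_lip f] is +oo, with inverse 0, so the distortion is 0. *)
by rewrite invey mule0 lee_fin ltW.
Qed.

(** When X has two points, a distortion below c forces both optimal constants to be finite and the
    lower one positive. They are attained: dividing by a positive distance turns the condition on
    each pair into a bound on the supremum or infimum. *)
Lemma euclidean_distortion_ltP X c : (euclidean_distortion X < c%:E)%E ->
  exists (H : hilbertType R) (f : X -> H) a, 0 < a /\ bilipschitz f a (c * a).
Proof.
rewrite /euclidean_distortion; case: asboolP => [[x0 X1]|X1] cE.
  exists (ell2 R), (fun=> 0), 1; split=> // x y.
  have [-> ->] : x = x0 /\ y = x0.
    by have : [set: X] x /\ [set: X] y by []; rewrite X1.
  by rewrite !mdistxx !mulr0 lexx.
have [_ [H [f <-]] {}cE] := ereal_inf_lt cE; exists H, f; move: cE.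
have [triv|/existsNP[x0 /existsNP[y0 /eqP xy0]]] :=
  pselect (forall x y : X, x = y).
  by exists 1; split=> // x y; rewrite (triv x y) !mdistxx !mulr0 lexx.
rewrite /distortion; case: ifPn => // /norP[lo0 upy] cE.
have dE (x y : X) : x = y \/ 0 < mdist x y.
  by have [->|xy] := eqVneq x y; [left|right; rewrite mdist_gt0].
have lo (x y : X) : (lower_lip f * (mdist x y)%:E <= (mdist (f x) (f y))%:E)%E.
  have [->|d0] := dE x y; first by rewrite !mdistxx mule0.
  rewrite -lee_pdivlMr//; apply: ge_ereal_sup => a [_ /(_ x y)].
  by rewrite lee_pdivlMr.
have up (x y : X) : ((mdist (f x) (f y))%:E <= upper_lip f * (mdist x y)%:E)%E.
  have [->|d0] := dE x y; first by rewrite !mdistxx mule0.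
  rewrite -lee_pdivrMr//; apply: le_ereal_inf_tmp => b [_ /(_ x y)].
  by rewrite lee_pdivrMr.
have lo_ge0 : (0 <= lower_lip f)%E.
  by apply: ereal_sup_ubound; split=> // x y; rewrite mul0e lee_fin mdist_ge0.
have up_ge0 : (0 <= upper_lip f)%E by apply: le_ereal_inf_tmp => b [].
have d0 : 0 < mdist x0 y0 by rewrite mdist_gt0.
have := lo x0 y0; move: lo_ge0 lo0 lo cE.
case: (lower_lip f) => [l| |]//; last by rewrite mulyr gtr0_sg// mul1e.
rewrite lee_fin eqe => l_ge0 l0 lo cE _; move: up_ge0 upy up cE.
case: (upper_lip f) => [u| |]// _ _ up.
rewrite inver (negbTE l0) -EFinM lte_fin.
have {l0 l_ge0} l0 : 0 < l by rewrite lt_neqAle eq_sym l0.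
rewrite ltr_pdivrMr// => ul; exists l; split=> // x y; apply/andP; split.
  by have := lo x y; rewrite -EFinM lee_fin.
have := up x y; rewrite -EFinM lee_fin => /le_trans; apply.
by rewrite ler_wpM2r ?mdist_ge0// ltW.
Qed.

End EuclideanDistortion.

(** * Separability and distances in orbit spaces *)

Section Euclidean.
Variable R : realType.

Lemma eucl_distE n (x y : euclidean R n) :
  mdist x y = Num.sqrt (\sum_i (x 0 i - y 0 i) ^+ 2).
Proof. by []. Qed.

Lemma euclidean_separable n : exists s : nat -> euclidean R n,
  forall x e, 0 < e -> exists i, mdist x (s i) < e.
Proof.
pose s i : euclidean R n :=
  if unpickle i is Some q then map_mx ratr (q : 'rV[rat]_n) else 0.
(* Coordinate errors below d give a squared distance of at most n d^2 < e^2. *)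
exists s => x e e0; pose d := e / n.+1%:R.
have d0 : 0 < d by rewrite divr_gt0.
have /choice[q qP] (j : 'I_n) : exists q : rat, `|x 0 j - ratr q| < d.
  have [|q] := @rat_in_itvoo R (x 0 j - d) (x 0 j + d).
    by rewrite ltrD2l gtrN.
  by rewrite in_itv/= => qP; exists q; rewrite distrC ltr_distl.
exists (pickle (\row_j q j)).
rewrite eucl_distE /s pickleK -[ltRHS]gtr0_norm// -sqrtr_sqr.
rewrite ltr_sqrt ?exprn_gt0//.
apply: (@le_lt_trans _ _ (\sum_(j < n) d ^+ 2)).
  apply: ler_sum => j _; rewrite !mxE -[leLHS]real_normK ?num_real//.
  by rewrite ler_pXn2r ?nnegrE// ?(ltW d0) ?ltW.
rewrite sumr_const card_ord /d expr_div_n -mulrnAr gtr_pMr ?exprn_gt0//.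
rewrite -mulr_natl ltr_pdivrMr ?exprn_gt0// mul1r -natrX ltr_nat.
by rewrite expnS expn1 (leq_trans (ltnSn n))// leq_pmull.
Qed.

End Euclidean.

Section OrbitSpace.
Variables (R : realType) (gT : finGroupType) (G : {group gT}) (V : orthRep R G).
Local Notation E := (euclidean R (orth_dim V)).
Implicit Types (x y : E) (g : gT).

Definition orbit_of x : orbit_space V :=
  exist _ (orth_orbit x) (imageT (@orth_orbit _ _ _ V) x).

Lemma orbit_of_surj o : exists x, orbit_of x = o.
Proof.
have [x ox] := orbit_space_rep o; exists x.
by case: o ox (orbit_spaceE ox) => o oP /= _ oE; apply: eq_exist; rewrite oE.
Qed.

Lemma orbit_of_act x g : g \in G -> orbit_of (orth_act x g) = orbit_of x.
Proof. by move=> gG; apply: eq_exist; exact: orth_orbit_act. Qed.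

Lemma mdist_orbit_le x y g : g \in G ->
  mdist (orbit_of x) (orbit_of y) <= mdist x (orth_act y g).
Proof.
by move=> gG; apply: orbit_dist_le; [exact: orth_orbit_refl|exists g].
Qed.

Lemma mdist_orbit_attained x y : exists2 g, g \in G &
  mdist (orbit_of x) (orbit_of y) = mdist x (orth_act y g).
Proof.
by have [q [g gG <-] dE] := @orbit_dist_attained _ _ _ _
  (orbit_of x) (orbit_of y) _ (orth_orbit_refl x); exists g.
Qed.

(** [f] is [F] composed with a choice of orbit representatives. *)
Lemma bilipschitz_on_orbits (Y : metricType R) (F : E -> Y) a b :
  (forall x y, a * mdist (orbit_of x) (orbit_of y) <= mdist (F x) (F y) <=
     b * mdist (orbit_of x) (orbit_of y)) ->
  exists f : orbit_space V -> Y, bilipschitz f a b.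
Proof.
move=> FP; have /choice[r rP] := orbit_of_surj.
by exists (F \o r) => o o'; have := FP (r o) (r o'); rewrite !rP.
Qed.

(** The orbit map does not increase distances, so it carries a dense sequence to a dense
    sequence. *)
Lemma orbit_space_separable : exists s : nat -> E,
  forall o e, 0 < e -> exists i, mdist o (orbit_of (s i)) < e.
Proof.
have [s sP] := euclidean_separable R (orth_dim V); exists s => o e e0.
have [x <-] := orbit_of_surj o; have [i xi] := sP x e e0; exists i.
by apply: le_lt_trans xi; rewrite -{2}(orth_act1 (s i)) mdist_orbit_le.
Qed.

End OrbitSpace.

(** * Contortion bounds as bilipschitz maps *)

Section Contortion.
Variables (R : realType) (gT : finGroupType) (G : {group gT}).

(** The zero-dimensional representation has a one-point orbit space. *)
Lemma contortion_ge1 : (1 <= contortion R G)%E.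
Proof.
have tP : mx_repr G (fun=> 1%:M : 'M[R]_0).
  by split=> [|g h _ _]; rewrite ?mulmx1.
have tO g : g \in G ->
    MxRepresentation tP g *m (MxRepresentation tP g)^T = 1%:M.
  by rewrite trmx1 mulmx1.
pose V := OrthRep tO; apply: ereal_sup_ubound; exists V => //.
rewrite /euclidean_distortion; case: asboolP => // -[].
exists (@orbit_of _ _ _ V 0); apply/seteqP; split=> // o _ /=.
by have [x <-] := orbit_of_surj o; congr orbit_of; apply/rowP => -[].
Qed.

Lemma contortion_lt_ge1 (c : R) : (contortion R G < c%:E)%E -> 1 <= c.
Proof. by move=> /ltW Gc; rewrite -lee_fin (le_trans contortion_ge1). Qed.

(** The strict inequality is what yields an actual map, since the infimum defining
    [euclidean_distortion] need not be attained. *)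
Lemma contortion_ltP (c : R) (V : orthRep R G) : (contortion R G < c%:E)%E ->
  exists (H : hilbertType R) (f : orbit_space V -> H) a,
    0 < a /\ bilipschitz f a (c * a).
Proof.
move=> Gc; apply: euclidean_distortion_ltP; apply: le_lt_trans Gc.
by apply: ereal_sup_ubound; exists V.
Qed.

Lemma contortion_leP (c : R) : 1 <= c -> (forall V : orthRep R G,
    exists (H : hilbertType R) (f : orbit_space V -> H) a,
      0 < a /\ bilipschitz f a (c * a)) ->
  (contortion R G <= c%:E)%E.
Proof.
move=> c1 hyp; apply: ge_ereal_sup => _ [V _ <-].
have [H [f [a [a0 fP]]]] := hyp V.
exact: bilipschitz_euclidean_distortion fP.
Qed.

End Contortion.

Section TrivialGroup.
Variables (R : realType) (gT : finGroupType).

(** Orbits are single points, and padding with zeros embeds R^n isometrically in [ell2]. *)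
Lemma contortion1 : (contortion R (1%G : {group gT}) <= 1)%E.
Proof.
apply: contortion_leP => // V; pose n := orth_dim V.
pose c (x : euclidean R n) k : R := if insub k is Some i then x 0 i else 0.
have c0 x k : (n <= k)%N -> c x k = 0.
  by move=> nk; rewrite /c; case: insubP => // i; rewrite ltnNge nk.
pose F x := Ell2 (ell2_of_finite (c0 x)).
have [x y|f fP] := @bilipschitz_on_orbits _ _ _ V (ell2 R) F 1 1; last first.
  by exists (ell2 R), f, 1; rewrite mulr1.
suff -> : mdist (F x) (F y) = mdist (orbit_of x) (orbit_of y).
  by rewrite mul1r lexx.
have [g /set1P-> ->] := mdist_orbit_attained x y.
rewrite orth_act1 hilbert_mdist eucl_distE -[LHS]ger0_norm// -sqrtr_sqr.
rewrite (@ell2_finite_norm _ _ n); last first.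
  by move=> k nk; rewrite [LHS](_ : _ = c x k - c y k)// !c0 ?subrr.
congr Num.sqrt; apply: eq_bigr => i _.
by rewrite [X in X ^+ 2](_ : _ = c x i - c y i)// /c !valK.
Qed.

End TrivialGroup.

(** * Normal subgroups *)

(** This brings finitely many values in H into a Euclidean space, as the definition of contortion
    requires. *)
Lemma finite_coordinates (R : realType) (H : hilbertType R) (J : finType)
    (v : J -> H) : exists w : J -> 'I_#|J| -> R,
  forall a b, `|v a - v b| ^+ 2 = \sum_k (w a k - w b k) ^+ 2.
Proof.
pose v' l := if insub l is Some o then v (enum_val (o : 'I_#|J|)) else 0.
have v'E a : v a = v' (enum_rank a) by rewrite /v' valK enum_rankK.
have [w _ wE] := triangular_coordinates v' #|J|.
exists (fun a k => w (enum_rank a) k) => a b; rewrite !v'E hinner_dist.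
rewrite !(wE _ _ #|J|)// -sumrMnl -sumrB -big_split; apply: eq_bigr => k _ /=.
by rewrite sqrrB !expr2.
Qed.

(* The group hT acts on (R^m)^hT by (u h)_k = u_(h k), a right action as in    *)
(* orth_act.                                                                   *)
Section TranslationRepresentation.
Variables (R : realType) (hT : finGroupType) (m : nat).
Local Notation J := (hT * 'I_m)%type.

Definition translate (h : hT) (j : 'I_#|{: J}|) : 'I_#|{: J}| :=
  enum_rank ((h * (enum_val j).1)%g, (enum_val j).2).

Lemma translate_inj h : injective (translate h).
Proof.
move=> j l /enum_rank_inj[/mulgI j1 j2]; apply: enum_val_inj.
by apply: injective_projections.
Qed.

Definition translation_perm h := perm (@translate_inj h).

Lemma translation_permM g h :
  translation_perm (g * h) = (translation_perm h * translation_perm g)%g.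
Proof.
by apply/permP => j; rewrite permM !permE /translate enum_rankK mulgA.
Qed.

(** The inverse compensates the order reversal in [translation_permM] and makes right multiplication
    send the coordinates u_j to u_(translate h j). *)
Definition translation_mx h : 'M[R]_#|{: J}| := perm_mx (translation_perm h)^-1.

Lemma translation_mx_repr (K : {group hT}) : mx_repr K translation_mx.
Proof.
split=> [|g h _ _]; rewrite /translation_mx.
  rewrite (_ : translation_perm 1 = 1%g) ?invg1 ?perm_mx1//.
  by apply/permP => j; rewrite permE perm1 /translate mul1g
    -surjective_pairing enum_valK.
by rewrite translation_permM invMg perm_mxM.
Qed.

Lemma translation_mx_orth g : translation_mx g *m (translation_mx g)^T = 1%:M.
Proof. by rewrite tr_perm_mx -perm_mxM mulgV perm_mx1. Qed.

Definition translation_rep (K : {group hT}) : orthRep R K :=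
  @OrthRep R hT K _ (MxRepresentation (translation_mx_repr K))
    (fun g _ => translation_mx_orth g).

Definition flatten_coords (u : hT -> 'I_m -> R) : euclidean R #|{: J}| :=
  \row_j u (enum_val j).1 (enum_val j).2.

Lemma orth_act_translation (K : {group hT}) u h :
  @orth_act _ _ _ (translation_rep K) (flatten_coords u) h =
  flatten_coords (fun k => u (h * k)%g).
Proof.
rewrite /orth_act/= /translation_mx -col_permE; apply/rowP => j.
by rewrite !mxE permE /translate enum_rankK.
Qed.

Lemma mdist_flatten_coords u u' :
  mdist (flatten_coords u) (flatten_coords u') =
  Num.sqrt (\sum_k \sum_i (u k i - u' k i) ^+ 2).
Proof.
rewrite eucl_distE pair_bigA (reindex _ (onW_bij _ (enum_val_bij {: J}))).
by congr Num.sqrt; apply: eq_bigr => j _; rewrite !mxE.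
Qed.

End TranslationRepresentation.

(** * Approximation from above in the extended reals *)

Section ErealBounds.
Variable R : realType.
Local Open Scope ereal_scope.
Implicit Types x y : \bar R.

Lemma le_of_real_ubounds x y : 0 <= y ->
  (forall c : R, y < c%:E -> x <= c%:E) -> x <= y.
Proof.
case: y => [r| |]// _ xP; last exact: leey.
by apply/lee_addgt0Pr => e e0; apply: xP; rewrite lte_fin ltrDl.
Qed.

Lemma le_of_real_ubounds_mul x y z : 1 <= y -> 1 <= z ->
  (forall c d : R, y < c%:E -> z < d%:E -> x <= (c * d)%:E) -> x <= y * z.
Proof.
case: y => [r| |]//; case: z => [s| |]//; rewrite ?lee_fin.
- move=> r1 s1 xP; apply: le_of_real_ubounds.
    by rewrite -EFinM lee_fin mulr_ge0// (le_trans ler01).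
  move=> c; rewrite -EFinM lte_fin => rsc.
  have t0 : (0 < (r + s + 1))%R by lra.
  (* Since e <= 1, (r + e)(s + e) <= r s + e (r + s + 1), which is at most c. *)
  pose e := Num.min 1%R ((c - r * s) / (r + s + 1))%R.
  have e0 : (0 < e)%R by rewrite lt_min ltr01 divr_gt0// subr_gt0.
  apply: (@le_trans _ _ ((r + e) * (s + e))%:E).
    by apply: xP; rewrite lte_fin ltrDl.
  rewrite lee_fin.
  rewrite (_ : (r + e) * (s + e) = r * s + e * (r + s + e))%R; last by ring.
  rewrite -lerBrDl (@le_trans _ _ (e * (r + s + 1))%R)//.
    by rewrite ler_pM2l// lerD2l ge_min lexx.
  by rewrite -ler_pdivlMr// ge_min lexx orbT.
- by move=> r1 _ _; rewrite gt0_muley ?leey// lte_fin; exact: lt_le_trans r1.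
- by move=> _ s1 _; rewrite gt0_mulye ?leey// lte_fin; exact: lt_le_trans s1.
- by move=> _ _ _; rewrite mulyy leey.
Qed.

End ErealBounds.

(** * Inflation, restriction and the action of G/N on V/N *)

Section Quotient.
Variables (R : realType) (gT : finGroupType) (G N : {group gT}).
Hypothesis nNG : (N <| G)%g.

Let GN : G \subset 'N(N)%g. Proof. exact: normal_norm. Qed.
Let NG : N \subset G. Proof. exact: normal_sub. Qed.

Definition inflation (W : orthRep R (G / N)%G) : orthRep R G :=
  @OrthRep R gT G _ (morphim_repr W GN)
    (fun g gG => orth_reprP W (mem_quotient N gG)).

Definition restriction (V : orthRep R G) : orthRep R N :=
  @OrthRep R gT N _ (subg_repr V NG)
    (fun g gN => orth_reprP V (fintype.subsetP NG g gN)).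

Lemma inflation_orbit W x :
  orth_orbit (V := inflation W) x = orth_orbit (V := W) x.
Proof.
apply/seteqP; split => [_ [g /= gG <-]|_ [h /= /morphimP[g _ gG ->] <-]].
  by exists (coset N g) => //=; exact: mem_quotient.
by exists g.
Qed.

Lemma contortion_quotient_le : (contortion R (G / N)%G <= contortion R G)%E.
Proof.
apply: le_of_real_ubounds => [|c Gc].
  exact: le_trans (contortion_ge1 R G).
apply: contortion_leP => [|W]; first exact: contortion_lt_ge1 Gc.
have [H [f [a [a0 fP]]]] := contortion_ltP (inflation W) Gc.
suff [f' f'P] : exists f' : orbit_space W -> H, bilipschitz f' a (c * a).
  by exists H, f', a.
pose orbI := @orbit_of _ _ _ (inflation W).
apply: (@bilipschitz_on_orbits _ _ _ W H (f \o orbI)) => x y.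
suff <- : mdist (orbI x) (orbI y) = mdist (orbit_of x) (orbit_of y).
  exact: fP.
by rewrite /mdist/= /orbit_dist/= !inflation_orbit.
Qed.

Section Upper.
Variable V : orthRep R G.
Local Notation E := (euclidean R (orth_dim V)).
Local Notation act := (@orth_act R gT G V).
Local Notation orbG := (@orbit_of R gT G V).
Local Notation orbN := (@orbit_of R gT N (restriction V)).
Implicit Types (x y : E) (g h : gT).

Lemma orbN_act x n : n \in N -> orbN (act x n) = orbN x.
Proof. exact: (@orbit_of_act _ _ _ (restriction V)). Qed.

(** Normality lets k move past N, as n k = k n^k; so k does not increase distances between N-orbits,
    and neither does its inverse. *)
Lemma mdist_orbN_act x y g : g \in G ->
  mdist (orbN (act x g)) (orbN (act y g)) = mdist (orbN x) (orbN y).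
Proof.
have le u v k : k \in G ->
    mdist (orbN (act u k)) (orbN (act v k)) <= mdist (orbN u) (orbN v).
  move=> kG; have [n nN ->] := mdist_orbit_attained (V := restriction V) u v.
  have nG := fintype.subsetP NG n nN.
  rewrite -(orth_act_isom (V := V) u _ kG) -orth_actM// (conjgC n k).
  have nkN : (n ^ k)%g \in N by rewrite memJ_norm// (fintype.subsetP GN).
  rewrite orth_actM// ?(fintype.subsetP NG)//.
  exact: (mdist_orbit_le (V := restriction V) (act u k) (act v k) nkN).
move=> gG; apply/eqP; rewrite eq_le le//=.
rewrite -{1}(orth_act1 x) -{1}(orth_act1 y) -(mulgV g) !orth_actM ?groupV//.
by rewrite le ?groupV.
Qed.

(** With [mdist_orbG_attained], this makes V/G the metric quotient of V/N. *)
Lemma mdist_orbG_le x y g : g \in G ->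
  mdist (orbG x) (orbG y) <= mdist (orbN x) (orbN (act y g)).
Proof.
move=> gG.
have [n nN ->] := mdist_orbit_attained (V := restriction V) x (act y g).
have nG := fintype.subsetP NG n nN.
by have := mdist_orbit_le (V := V) x y (groupM gG nG); rewrite orth_actM.
Qed.

Lemma mdist_orbG_attained x y : exists2 g, g \in G &
  mdist (orbN x) (orbN (act y g)) <= mdist (orbG x) (orbG y).
Proof.
have [g gG ->] := mdist_orbit_attained (V := V) x y; exists g => //.
have := mdist_orbit_le (V := restriction V) x (act y g) (group1 N).
by rewrite orth_act1.
Qed.

(** The action of G on N-orbits factors through G/N, so [repr] may be used to act by a coset. *)
Lemma orbN_coset x g h : g \in G -> h \in G -> coset N g = coset N h ->
  orbN (act x g) = orbN (act x h).
Proof.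
move=> gG hG /(kercoset_rcoset (fintype.subsetP GN g gG)
  (fintype.subsetP GN h hG))[z zN ->].
have zhN : (z ^ h)%g \in N by rewrite memJ_norm// (fintype.subsetP GN).
by rewrite conjgC orth_actM ?(fintype.subsetP NG (z ^ h)%g)// orbN_act.
Qed.

Lemma repr_quotient k : k \in (G / N)%g -> repr k \in G.
Proof.
move=> /morphimP[g gN gG kE].
have [z zN ->] :=
  kercoset_rcoset (repr_coset_norm k) gN (etrans (coset_reprK k) kE).
by rewrite groupM// (fintype.subsetP NG).
Qed.

Section FiniteStage.
Variables (H : hilbertType R) (F : E -> H) (a c : R) (s : nat -> E) (n : nat).
Hypotheses (a0 : 0 <= a) (c1 : 1 <= c).
Hypothesis FP : forall x y, a * mdist (orbN x) (orbN y) <= `|F x - F y| <=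
  c * a * mdist (orbN x) (orbN y).
Local Notation K := (G / N)%G.

(** The block of [p i] at k in K holds coordinates of F(s_i k). Acting by h shifts blocks, and k is
    an isometry of N-orbits, so each of the |K| blocks of the difference has norm between a D and c
    a D; summing squares gives the factor sqrt |K|. *)
Lemma induced_quotient_rep :
  exists (W : orthRep R K) (p : nat -> euclidean R (orth_dim W)),
  forall i j (h : coset_of N) D, (i < n)%N -> (j < n)%N -> h \in K ->
    D = mdist (orbN (s i)) (orbN (act (s j) (repr h))) ->
    Num.sqrt #|K|%:R * a * D <= mdist (p i) (orth_act (p j) h) <=
    c * (Num.sqrt #|K|%:R * a) * D.
Proof.
pose J := (coset_of N * 'I_n.+1)%type.
(* coset_of N is all of N(N)/N; cosets outside G/N get 0. *)
pose v (j : J) : H := if j.1 \in K then F (act (s j.2) (repr j.1)) else 0.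
have [w wP] := finite_coordinates v.
exists (translation_rep R #|{: J}| K).
exists (fun i => flatten_coords (fun k l => w (k, inord i) l)).
move=> i j h D im jn hK DE.
have vP k : k \in K ->
    a * D <= `|v (k, inord i) - v ((h * k)%g, inord j)| <= c * a * D.
  move=> kK; have hkK : (h * k)%g \in K by exact: groupM.
  rewrite /v/= kK hkK (inordK (leqW im)) (inordK (leqW jn)) DE.
  have [hG kG hkG] :=
    And3 (repr_quotient hK) (repr_quotient kK) (repr_quotient hkK).
  (* Both orbits are moved by [repr k]; then [repr h * repr k] and [repr (h * k)] represent the same
     coset. *)
  rewrite -(mdist_orbN_act _ _ kG) -orth_actM//.
  rewrite (orbN_coset (s j) (groupM hG kG) hkG)//.
  by rewrite coset_reprK coset_morphM ?repr_coset_norm// !coset_reprK.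
rewrite orth_act_translation mdist_flatten_coords.
have -> : \sum_k \sum_l (w (k, inord i) l - w ((h * k)%g, inord j) l) ^+ 2 =
    \sum_(k in K) `|v (k, inord i) - v ((h * k)%g, inord j)| ^+ 2.
  rewrite [RHS]big_mkcond/=; apply: eq_bigr => k _; rewrite -wP.
  (* For h in K, the element h k lies outside K exactly when k does, so both blocks are zero. *)
  case: ifPn => // kK; rewrite /v/= (negbTE kK) groupMl// (negbTE kK).
  by rewrite subrr normr0 expr0n.
have D0 : 0 <= D by rewrite DE mdist_ge0.
have sqrtE (b : R) : 0 <= b ->
    Num.sqrt #|K|%:R * b = Num.sqrt (\sum_(k in K) b ^+ 2).
  move=> b0; rewrite sumr_const -[X in _ = Num.sqrt X]mulr_natl sqrtrM//.
  by rewrite sqrtr_sqr ger0_norm.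
have c0 : 0 <= c by exact: le_trans c1.
rewrite mulrCA -!mulrA !sqrtE ?mulr_ge0//.
apply/andP; split; rewrite ler_wsqrtr//; apply: ler_sum => k kK.
  by rewrite ler_pXn2r ?nnegrE ?mulr_ge0//; have /andP[] := vP k kK.
by rewrite ler_pXn2r ?nnegrE ?mulr_ge0// mulrA; have /andP[] := vP k kK.
Qed.

End FiniteStage.

Lemma orbit_space_extension_bilipschitz (c d : R) :
  (contortion R (G / N)%G < c%:E)%E -> (contortion R N < d%:E)%E ->
  exists (H : hilbertType R) (f : orbit_space V -> H) a,
    0 < a /\ bilipschitz f a (c * d * a).
Proof.
move=> Kc Nd; have [H [f [a [a0 fP]]]] := contortion_ltP (restriction V) Nd.
have [c1 d1] := (contortion_lt_ge1 Kc, contortion_lt_ge1 Nd).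
have [c0 d0] : 0 < c /\ 0 <= d by rewrite (lt_le_trans _ c1) ?(le_trans _ d1).
have [s sP] := orbit_space_separable V.
have [b b0 bE] : exists2 b, 0 < b & Num.sqrt #|(G / N)%G|%:R * a = b.
  by eexists; [|reflexivity]; rewrite mulr_gt0// sqrtr_gt0 ltr0n cardG_gt0.
suff [g gP] : exists g : orbit_space V -> ell2 R,
    bilipschitz g b (c * d * b).
  by exists (ell2 R), g, b.
apply: (@separable_bilipschitz_limit _ _ (orbG \o s)) => //; first exact: ltW.
  exact: (mulr_ge0 (mulr_ge0 (ltW c0) d0) (ltW b0)).
move=> n; pose F x := f (orbN x).
have FP x y : a * mdist (orbN x) (orbN y) <= `|F x - F y| <=
    d * a * mdist (orbN x) (orbN y) by rewrite -hilbert_mdist; exact: fP.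
have [W [p]] := induced_quotient_rep s n (ltW a0) d1 FP; rewrite bE => pP.
have [H' [g [e [e0 gP]]]] := contortion_ltP W Kc.
(* The constant e depends on n; dividing by it leaves b and c d b, uniform in n. *)
exists H', (fun i => e^-1 *: g (orbit_of (p i))) => i j im jn /=.
rewrite hilbert_mdist -scalerBr normrZ gtr0_norm ?invr_gt0// -hilbert_mdist.
have /andP[glo gup] := gP (orbit_of (p i)) (orbit_of (p j)).
apply/andP; split.
  rewrite ler_pdivlMl//; apply: le_trans glo; rewrite ler_pM2l//.
  have [h hK ->] := mdist_orbit_attained (p i) (p j).
  have /andP[+ _] := pP i j h _ im jn hK erefl; apply: le_trans.
  by rewrite ler_pM2l// mdist_orbG_le// repr_quotient.
rewrite ler_pdivrMl//; apply: (le_trans gup).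
rewrite -!mulrA [leRHS]mulrCA ler_pM2l// ler_pM2l// mulrA.
(* For the upper bound, the coset of an element realising the G-orbit distance is a competitor for
   the K-orbit distance. *)
have [k kG kle] := mdist_orbG_attained (s i) (s j).
have cK : coset N k \in (G / N)%G by exact: mem_quotient.
apply: le_trans (mdist_orbit_le (p i) (p j) cK) _.
have /andP[_ ple] := pP i j _ _ im jn cK erefl; apply: (le_trans ple).
rewrite ler_wpM2l ?mulr_ge0 ?(ltW b0)//.
by rewrite (orbN_coset _ (repr_quotient cK) kG) ?coset_reprK.
Qed.

End Upper.

Lemma contortion_extension_le :
  (contortion R G <= contortion R (G / N)%G * contortion R N)%E.
Proof.
apply: le_of_real_ubounds_mul => [||c d Kc Nd]; [exact: contortion_ge1..|].
apply: contortion_leP => [|V]; last exact: orbit_space_extension_bilipschitz.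
by rewrite -[1]mulr1 ler_pM//;
  [exact: contortion_lt_ge1 Kc|exact: contortion_lt_ge1 Nd].
Qed.

End Quotient.

(** * The two inequalities and the induction along a series *)

Local Open Scope ereal_scope.

Theorem theorem9 (R : realType) (gT : finGroupType) (G : {group gT}) :
  (forall N : {group gT}, (N <| G)%g ->
     contortion R (G / N)%G <= contortion R G /\
     contortion R G <= contortion R (G / N)%G * contortion R N) /\
  (forall (r : nat) (Gs : nat -> {group gT}),
     Gs 0%N = 1%G -> Gs r = G ->
     (forall i : nat, (i < r)%N -> (Gs i <| Gs i.+1)%g) ->
     contortion R G <= \prod_(i < r) contortion R (Gs i.+1 / Gs i)%G).
Proof.
split=> [N nNG|r Gs Gs0 <- nGs].
  by split; [exact: contortion_quotient_le|exact: contortion_extension_le].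
elim: r nGs => [|r IHr] nGs; first by rewrite big_ord0 Gs0 contortion1.
rewrite big_ord_recr/= muleC.
apply: le_trans (contortion_extension_le R (nGs r (ltnSn r))) _.
(* The new factor is at least 1, so multiplying by it preserves the inductive bound. *)
apply: lee_wpmul2l; first exact: le_trans (contortion_ge1 _ _).
by apply: IHr => i ir; apply: nGs; exact: ltnW.
Qed.
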